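(* Let $D$ be a finite simple digraph and let $x,y,z$ be vertices such that $xyz$ is a path of length $2$ in the underlying graph $G[D]$ with $yx, yz \in A(D)$. Then \[b_I(D) \leq \deg_{G[D]}(x) + \deg_D^-(y) + \deg_{G[D]}(z) - |N^-(x)\cap N^-(y)\cap N^-(z)|.\] Moreover, if $x$ and $z$ are adjacent in $G[D]$, then \[b_I(D) \leq \deg_{G[D]}(x) + \deg_D^-(y) + \deg_{G[D]}(z) - 1 - |N^-(x)\cap N^-(y)\cap N^-(z)|.\]
   Context: A finite simple digraph has no loops and no multiple arcs (oppositely oriented arcs allowed). $N^-(v)=N_D^-(v)$ denotes the set of in-neighbors of $v$ in $D$ and $\deg_D^-(v)=|N_D^-(v)|$. The underlying graph $G[D]$ is the multigraph obtained by replacing each arc $uv$ by an edge $uv$ (so $G[D]$ has two parallel edges $uv$ when both $uv,vu\in A(D)$); $\deg_{G[D]}(v)$ is the degree of $v$ in $G[D]$. An Italian dominating function (IDF) on $D$ is a function $f:V(D)\to\{0,1,2\}$ such that every vertex $v$ with $f(v)=0$ has at least two in-neighbors $w$ with $f(w)=1$ or at least one in-neighbor $w$ with $f(w)=2$; its weight is $\sum_{u}f(u)$ and $\gamma_I(D)$ is the minimum weight of an IDF. The Italian bondage number $b_I(D)$ is the minimum number of arcs of $A(D)$ whose removal from $D$ (keeping all vertices) results in a digraph $D'$ with $\gamma_I(D')>\gamma_I(D)$. *)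

(* Defs.v *)
From mathcomp Require Import all_boot all_order all_algebra.

Set Implicit Arguments.
Unset Strict Implicit.
Unset Printing Implicit Defensive.

(* A finite digraph without multiple arcs is a relation [D : rel V] on a      *)
(* finType, with [D u v] iff uv is an arc; it is simple when moreover         *)
(* [irreflexive D].                                                           *)

Definition arcs (V : finType) (D : rel V) : {set V * V} :=
  [set e | D e.1 e.2].

Definition in_nbhd (V : finType) (D : rel V) (v : V) : {set V} :=
  [set u | D u v].

Definition in_deg (V : finType) (D : rel V) (v : V) : nat := #|in_nbhd D v|.

Definition del_arcs (V : finType) (D : rel V) (S : {set V * V}) : rel V :=
  [rel u v | D u v && ((u, v) \notin S)].

(* The edges of the underlying multigraph G[D] are the arcs of D with their   *)
(* orientation forgotten: opposite arcs uv, vu yield two parallel edges, both *)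
(* of which count in the degree.                                              *)
Definition und_adj (V : finType) (D : rel V) : rel V :=
  [rel u v | D u v || D v u].

Definition und_deg (V : finType) (D : rel V) (v : V) : nat :=
  #|[set e in arcs D | (e.1 == v) || (e.2 == v)]|.

Definition italian_dominating (V : finType) (D : rel V)
    (f : {ffun V -> 'I_3}) : bool :=
  [forall v : V, (f v == 0 :> nat) ==>
     ((2 <= #|[set w in in_nbhd D v | f w == 1 :> nat]|)
      || (1 <= #|[set w in in_nbhd D v | f w == 2 :> nat]|))].

Definition weight (V : finType) (f : {ffun V -> 'I_3}) : nat :=
  \sum_(u : V) f u.

(* The constant function 1 is always an Italian dominating function, so the   *)
(* minimum is over a nonempty set.                                            *)
Definition italian_domination_number (V : finType) (D : rel V) : nat :=
  weight [arg min_(f < [ffun=> inord 1] | italian_dominating D f) weight f].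

Definition italian_bondage_set (V : finType) (D : rel V) (S : {set V * V}) :
    bool :=
  (S \subset arcs D) &&
  (italian_domination_number D < italian_domination_number (del_arcs D S)).

(* [b] is the Italian bondage number of D. This is a relation because some    *)
(* digraphs (e.g. those without arcs) have no bondage set, and hence no       *)
(* Italian bondage number.                                                    *)
Definition is_italian_bondage_number (V : finType) (D : rel V) (b : nat) :
    Prop :=
  (exists2 S : {set V * V}, italian_bondage_set D S & #|S| = b) /\
  (forall S : {set V * V}, italian_bondage_set D S -> b <= #|S|).

(* Main.v *)
Require Import Defs.
From mathcomp Require Import all_boot all_order all_algebra.
From mathcomp Require Import zify.

Set Implicit Arguments.
Unset Strict Implicit.
Unset Printing Implicit Defensive.

(** Let W be the set of common in-neighbors of x, y and z, and delete all arcs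
    incident with x or z, together with the arcs entering y from outside W.
    An Italian dominating function f of the remaining digraph is positive at x
    and z, which have become isolated.  If f y > 0 as well, then moving all the
    weight of x, y, z to the single value 2 at y saves weight at least 1 and is
    Italian dominating in D because of the arcs yx and yz.  If f y = 0, then
    the vertices of W dominate y, hence they dominate x in D, and f x can be
    lowered to 0. *)

(** Values are at most 2, so a total of at least 2 over the in-neighbors needs either one value 2 or
    two values 1. In this form domination can be transferred by comparing sums. *)
Lemma italian_dominatingP (V : finType) (D : rel V) (f : {ffun V -> 'I_3}) :
  reflect (forall v, f v = 0 :> nat -> 2 <= \sum_(w | D w v) f w)
          (italian_dominating D f).
Proof.
have le2 w : f w <= 2 by rewrite -ltnS.
apply: (iffP forallP) => [domf v fv0 | domf v]; last apply/implyP => /eqP fv0.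
  have /implyP/(_ (introT eqP fv0))/orP[ones | /card_gt0P[w]] := domf v.
    apply: leq_trans ones _; rewrite -sum1_card.
    rewrite [X in X <= _]big_mkcond [X in _ <= X]big_mkcond /=.
    by apply: leq_sum => w _; rewrite !inE; case: (D w v) => //=; case: eqP => // ->.
  by rewrite !inE => /andP[Dwv /eqP fw2]; rewrite (bigD1 w) //= fw2.
have [//|/= no2] := boolP (1 <= #|[set w in in_nbhd D v | f w == 2 :> nat]|).
  by rewrite orbT.
rewrite orbF; apply: leq_trans (domf v fv0) _; rewrite -sum1_card.
rewrite [X in X <= _]big_mkcond [X in _ <= X]big_mkcond /=.
apply: leq_sum => w _; rewrite !inE; case Dwv: (D w v) => //=.
(* With no in-neighbor of value 2, every value in the sum is 0 or 1, so the sum counts the ones. *)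
have fw_neq2 : f w != 2 :> nat.
  apply: contra no2 => fw2; apply/card_gt0P; exists w.
  by rewrite !inE Dwv fw2.
by have := le2 w; case: (nat_of_ord (f w)) fw_neq2 => [|[|[|k]]].
Qed.

Lemma italian_domination_number_min (V : finType) (D : rel V)
    (f : {ffun V -> 'I_3}) :
  italian_dominating D f -> italian_domination_number D <= weight f.
Proof.
move=> domf; rewrite /italian_domination_number.
case: arg_minnP => [|g _]; last exact.
(* The default of the [arg min], the constant 1, dominates vacuously: it vanishes nowhere. *)
by apply/forallP => v; rewrite ffunE inordK.
Qed.

Lemma italian_domination_number_attained (V : finType) (D : rel V) :
  exists2 f, italian_dominating D f & weight f = italian_domination_number D.
Proof.
rewrite /italian_domination_number.
case: arg_minnP => [|f domf _]; last by exists f.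
by apply/forallP => v; rewrite ffunE inordK.
Qed.

Lemma italian_bondage_number_exists (V : finType) (D : rel V)
    (S : {set V * V}) :
  italian_bondage_set D S ->
  exists2 b, is_italian_bondage_number D b & b <= #|S|.
Proof.
move=> bondS.
case: (@arg_minnP _ S (italian_bondage_set D) (fun T => #|T|)) => // T bondT minT.
by exists #|T|; [split; [exists T | ] | exact: minT].
Qed.

(** The two vertices may differ, so that what dominates [y] after the deletion can be reused to
    dominate [x] in [D]. *)
Lemma leq_in_sum (V : finType) (D D' : rel V) (f g : {ffun V -> 'I_3}) (u v : V) :
  (forall w, D' w u -> D w v /\ f w <= g w) ->
  \sum_(w | D' w u) f w <= \sum_(w | D w v) g w.
Proof.
move=> le_fg; rewrite big_mkcond [X in _ <= X]big_mkcond /=.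
apply: leq_sum => w _; case D'wu: (D' w u) => //.
by have [-> ->] := le_fg _ D'wu.
Qed.

Section BondageSet.

Variables (V : finType) (D : rel V) (x y z : V).
Let W := in_nbhd D x :&: in_nbhd D y :&: in_nbhd D z.
Let Ex := [set e in arcs D | (e.1 == x) || (e.2 == x)].
Let Ez := [set e in arcs D | (e.1 == z) || (e.2 == z)].
Let Ey := [set (w, y) | w in in_nbhd D y :\: W].
Let S := Ex :|: Ez :|: Ey.

Lemma arc_kept (u v : V) :
  del_arcs D S u v ->
  [/\ D u v, u != x, u != z, v != x & v != z /\ (v = y -> u \in W)].
Proof.
rewrite /del_arcs /= in_setU => /andP[Duv]; rewrite !inE /= Duv /=.
rewrite !negb_or => /andP[/andP[/andP[-> ->] /andP[-> ->]] nEy].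
split=> //; split=> // eq_vy; subst v; apply: contraR nEy => nWu.
by apply/imsetP; exists u; rewrite // !inE nWu Duv.
Qed.

Lemma isolated_positive (f : {ffun V -> 'I_3}) (v : V) :
  italian_dominating (del_arcs D S) f -> v \in [:: x; z] -> 0 < f v.
Proof.
move=> /italian_dominatingP domf xzv; rewrite lt0n; apply/eqP => /domf.
rewrite big1 // => w /arc_kept[_ _ _ nvx [nvz _]].
by move: xzv; rewrite !inE (negPf nvx) (negPf nvz).
Qed.

(** An arc joining [x] and [z] lies in both [Ex] and [Ez], so inclusion-exclusion saves 1 when they
    are adjacent; the arcs from [W] to [y] are not deleted, which saves [#|W|]. The boolean
    [und_adj D x z], read as 0 or 1, covers both bounds of the theorem at once. *)
Lemma card_incident_arcs :
  #|S| + und_adj D x z + #|W| <= und_deg D x + in_deg D y + und_deg D z.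
Proof.
have -> : und_deg D x = #|Ex| by [].
have -> : und_deg D z = #|Ez| by [].
have cardW : #|W| + #|in_nbhd D y :\: W| = in_deg D y.
  rewrite /in_deg -(cardsID W (in_nbhd D y)) (setIidPr _) //.
  by apply/subsetP => w; rewrite !inE => /andP[/andP[]].
have cardEy : #|Ey| <= #|in_nbhd D y :\: W| by exact: leq_imset_card.
have adjI : und_adj D x z <= #|Ex :&: Ez|.
  case adj: (und_adj D x z) => //=; apply/card_gt0P.
  case/orP: adj => Dxz; [exists (x, z) | exists (z, x)];
    by rewrite !inE /= Dxz !eqxx ?orbT.
(* Only an inequality: [Ey] may meet [Ex] or [Ez], for instance in an arc from [x] to [y]. *)
have cardU : #|S| <= #|Ex :|: Ez| + #|Ey| by rewrite /S cardsU leq_subr.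
have cardI := cardsUI Ex Ez.
lia.
Qed.

Hypotheses (neq_xy : x != y) (neq_xz : x != z) (neq_yz : y != z).
Hypotheses (arc_yx : D y x) (arc_yz : D y z).

Lemma lighter_dominating (f : {ffun V -> 'I_3}) :
  italian_dominating (del_arcs D S) f ->
  exists2 g, italian_dominating D g & weight g < weight f.
Proof.
move=> domf.
have fx := isolated_positive domf (mem_head x _).
have fz : 0 < f z by apply: isolated_positive; rewrite // !inE eqxx orbT.
have /italian_dominatingP sumf := domf.
have neq_yx : y != x by rewrite eq_sym.
have neq_zx : z != x by rewrite eq_sym.
have neq_zy : z != y by rewrite eq_sym.
have [fy0 | fy] := posnP (f y).
  exists [ffun u => if u == x then ord0 else f u].
    apply/italian_dominatingP => v; rewrite ffunE.
    have le_g w : w != x ->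
        f w <= [ffun u => if u == x then ord0 else f u] w.
      by move=> nwx; rewrite ffunE (negPf nwx).
    case: eqP => [-> _ | _ fv0].
      (* Every remaining in-neighbor of [y] lies in [W], hence is an in-neighbor of [x] in [D] and
         keeps its value. *)
      apply: leq_trans (sumf y fy0) _; apply: leq_in_sum => w.
      move=> /arc_kept[_ nwx _ _ [_ /(_ erefl)]].
      by rewrite !inE => /andP[/andP[-> _] _]; split=> //; exact: le_g.
    (* No remaining arc leaves [x], so the value lowered there contributed nothing at [v]. *)
    apply: leq_trans (sumf v fv0) _; apply: leq_in_sum => w.
    by move=> /arc_kept[-> nwx _ _ _]; split=> //; exact: le_g.
  rewrite /weight (bigD1 x) //= [X in _ < X](bigD1 x) //= ffunE eqxx /=.
  rewrite (eq_bigr (fun u => f u : nat)); first by rewrite ltn_add2r.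
  by move=> u /negPf nux; rewrite ffunE nux.
pose g := [ffun u => if u == y then inord 2 : 'I_3
                     else if (u == x) || (u == z) then ord0 else f u].
have gy : g y = 2 :> nat by rewrite ffunE eqxx inordK.
have gx : g x = 0 :> nat by rewrite ffunE (negPf neq_xy) eqxx.
have gz : g z = 0 :> nat by rewrite ffunE (negPf neq_zy) eqxx orbT.
have gE u : u != x -> u != y -> u != z -> g u = f u.
  by move=> /negPf nux /negPf nuy /negPf nuz; rewrite ffunE nux nuy nuz.
exists g; last first.
  (* Off [x], [y], [z] the functions agree; on these three vertices [g] totals 2, while [f] is
     positive at each and totals at least 3. *)
  rewrite /weight (bigD1 x) // (bigD1 y) // (bigD1 z) ?neq_zx //=.
  rewrite [X in _ < X](bigD1 x) // [X in _ < _ + X](bigD1 y) //.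
  rewrite [X in _ < _ + (_ + X)](bigD1 z) ?neq_zx //=.
  rewrite gx gy gz (eq_bigr (fun u => f u : nat)); first by rewrite !addnA ltn_add2r; lia.
  by move=> u /andP[/andP[nux nuy] nuz]; rewrite gE.
apply/italian_dominatingP => v gv0.
have via_y : D y v -> 2 <= \sum_(w | D w v) g w.
  by move=> Dyv; rewrite (bigD1 y) //= gy.
have [eq_vx | nvx] := eqVneq v x; first by apply: via_y; rewrite eq_vx.
have [eq_vz | nvz] := eqVneq v z; first by apply: via_y; rewrite eq_vz.
have [eq_vy | nvy] := eqVneq v y; first by rewrite eq_vy gy in gv0.
rewrite gE // in gv0; apply: leq_trans (sumf v gv0) _.
(* A remaining arc starts at neither [x] nor [z], the only places where [g] can be below [f]; at [y]
   it takes the maximal value 2. *)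
apply: leq_in_sum => w /arc_kept[-> nwx nwz _ _]; split=> //.
have [-> | nwy] := eqVneq w y; last by rewrite gE.
by rewrite gy -ltnS.
Qed.

Lemma incident_arcs_bondage_set : italian_bondage_set D S.
Proof.
apply/andP; split.
  apply/subsetP => e /setUP[/setUP[] | /imsetP[w + ->]];
    by rewrite !inE => /andP[].
have [f domf <-] := italian_domination_number_attained (del_arcs D S).
have [g domg] := lighter_dominating domf.
exact/leq_ltn_trans/italian_domination_number_min.
Qed.

End BondageSet.

Theorem theorem3p1 (V : finType) (D : rel V) (x y z : V)
    (simpleD : irreflexive D)
    (xyz_walk : path (und_adj D) x [:: y; z])
    (xyz_uniq : uniq [:: x; y; z])
    (arc_yx : D y x) (arc_yz : D y z) :
  exists b : nat,
    [/\ is_italian_bondage_number D b,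
        (b%:Z <= (und_deg D x)%:Z + (in_deg D y)%:Z + (und_deg D z)%:Z
                 - #|in_nbhd D x :&: in_nbhd D y :&: in_nbhd D z|%:Z)%R
      & und_adj D x z ->
        (b%:Z <= (und_deg D x)%:Z + (in_deg D y)%:Z + (und_deg D z)%:Z - 1
                 - #|in_nbhd D x :&: in_nbhd D y :&: in_nbhd D z|%:Z)%R].
Proof.
move: xyz_uniq; rewrite /= !inE negb_or andbT.
move=> /andP[/andP[neq_xy neq_xz] neq_yz].
have [b bD leb] := italian_bondage_number_exists
  (incident_arcs_bondage_set neq_xy neq_xz neq_yz arc_yx arc_yz).
have bound : b + und_adj D x z
    + #|in_nbhd D x :&: in_nbhd D y :&: in_nbhd D z|
    <= und_deg D x + in_deg D y + und_deg D z.
  by apply: leq_trans (card_incident_arcs D x y z); rewrite !leq_add2r.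
exists b; split=> // [|adj]; last rewrite adj /= in bound; lia.
Qed.
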